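(* Let $n\ge2$ and $\rho\in\mathbb{C}\setminus\{-1,1\}$. The following four statements are equivalent: (i) all $n$ eigenvalues of $K_n(\rho)$ lie in $\mathrm{range}\{\sigma(\rho,\theta)\}$; (ii) all $2n$ zeros of $p_{2n}(\rho,z)$ lie on the unit circle; (iii) $-1<\rho<1$; (iv) $K_n(\rho)$ is positive definite.
   Context: $K_n(\rho)=\left[\rho^{|j-k|}\right]_{j,k=1}^n$ (with $\rho^0=1$). $p_{2n}(\rho,z)=z^{2n}+(1+\rho^2)\sum_{k=1}^{n-1}z^{2k}-2\rho\sum_{k=0}^{n-1}z^{2k+1}+1$. $\sigma(\rho,\theta)=\frac{1-\rho^2}{1-2\rho\cos\theta+\rho^2}$ and $\mathrm{range}\{\sigma(\rho,\theta)\}=\{\sigma(\rho,\theta):\theta\in(-\pi,\pi],\ 1-2\rho\cos\theta+\rho^2\neq0\}$. Positive definite means $x^*K_n(\rho)x>0$ for all nonzero $x\in\mathbb{C}^n$. *)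

(* Defs.v *)
From HB Require Import structures.
From mathcomp Require Import all_boot all_order all_algebra.
From mathcomp Require Import complex.
From mathcomp Require Import reals trigo.
Set Implicit Arguments. Unset Strict Implicit. Unset Printing Implicit Defensive.
Import Order.TTheory GRing.Theory Num.Theory.
Local Open Scope ring_scope.
Local Open Scope complex_scope.

(* Kac–Murdock–Szegő matrix K_n(rho) = [rho^|j-k|]_{j,k}, with rho^0 = 1. *)
Definition KMS (R : realType) (n : nat) (rho : R[i]) : 'M[R[i]]_n :=
  \matrix_(j < n, k < n) rho ^+ (maxn j k - minn j k).

Definition p2n (R : realType) (n : nat) (rho : R[i]) : {poly R[i]} :=
  'X^(2 * n) + (1 + rho ^+ 2) *: (\sum_(1 <= k < n) 'X^(2 * k))
  - (2 * rho) *: (\sum_(0 <= k < n) 'X^(2 * k + 1)) + 1.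

Definition sigma (R : realType) (rho : R[i]) (theta : R) : R[i] :=
  (1 - rho ^+ 2) / (1 - 2 * rho * (cos theta)%:C + rho ^+ 2).

Definition sigma_range (R : realType) (rho : R[i]) : R[i] -> Prop :=
  fun w => exists theta : R, [/\ - pi < theta, theta <= pi,
    1 - 2 * rho * (cos theta)%:C + rho ^+ 2 != 0 & w = sigma rho theta].

Definition posdef (R : realType) (n : nat) (K : 'M[R[i]]_n) : Prop :=
  forall x : 'cV[R[i]]_n, x != 0 ->
    0 < ((map_mx conjc x)^T *m K *m x) 0 0.

(* Main.v *)
(* Everything goes through the tridiagonal matrix T = (1 - rho^2) K_n(rho)^-1 and the
   identity (z^2 - 1) p_2n(z) = z^(2n) (z - rho)^2 - (1 - rho z)^2.
   (i) => (ii): a zero z <> 1, -1 of p_2n makes v_j = z^(j+1) +- z^(n-j) an eigenvector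
   of T with eigenvalue 1 - rho (z + 1/z) + rho^2; if the corresponding eigenvalue of K_n
   is sigma(rho, theta), then z + 1/z = 2 cos theta.
   (ii) => (iii): with all zeros a on the unit circle, the sum of the zeros, 2 rho, is
   conjugate to the sum of the 1/a, which is again 2 rho because p_2n is palindromic; so
   rho is real.  If |rho| > 1, the right-hand side of the identity is negative at rho and
   positive at 2 rho, which gives a real zero of modulus > 1.
   (iii) => (iv): K_n = L D L^T with D = diag(1, 1 - rho^2, ..., 1 - rho^2).
   (iv) => (i): testing on e_0 +- e_1 gives (iii); Gershgorin's theorem applied to T then
   confines the eigenvalues of K_n to the range of sigma. *)
Require Import Defs.
From HB Require Import structures.
From mathcomp Require Import all_boot all_order all_algebra.
From mathcomp Require Import complex.
From mathcomp Require Import reals trigo.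
From mathcomp Require Import ring lra zify.
Set Implicit Arguments. Unset Strict Implicit. Unset Printing Implicit Defensive.
Import Order.TTheory GRing.Theory Num.Theory.
Local Open Scope ring_scope.
Local Open Scope complex_scope.

(** * The tridiagonal matrix T and its product with K_n *)

Definition kms_tridiag (C : fieldType) (n : nat) (rho : C) : 'M[C]_n :=
  \matrix_(i < n, j < n)
    (((i == j)%:R * (1 + rho ^+ 2 - rho ^+ 2 *+ (i == 0 :> nat)
                     - rho ^+ 2 *+ (i.+1 == n)))
     - rho *+ (i.+1 == j) - rho *+ (j.+1 == i)).

Lemma sum_nat_delta (C : fieldType) (f : nat -> C) (n c : nat) :
  \sum_(i < n) f i *+ (i == c :> nat) = f c *+ (c < n)%N.
Proof.
have [cn|cn] := ltnP c n.
  rewrite (bigD1 (Ordinal cn)) //= eqxx big1 ?addr0 // => i /negP ic.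
  by case: eqP => // e; case: ic; apply/eqP/val_inj.
by rewrite big1 // => i _; case: eqP => // e; move: (ltn_ord i); rewrite e ltnNge cn.
Qed.

(** The row vector is a function on [nat], so that neighbours are plain [j.-1] and [j.+1]; the
    boolean multiples discard them at the two ends, where [j.-1] for [j] = 0 is again 0. *)
Lemma kms_tridiag_sum (C : fieldType) (n : nat) (rho : C) (f : nat -> C)
    (j : 'I_n) :
  \sum_(i < n) f i * kms_tridiag n rho i j =
  f j * (1 + rho ^+ 2 - rho ^+ 2 *+ (j == 0 :> nat) - rho ^+ 2 *+ (j.+1 == n))
  - rho * f j.-1 *+ (0 < j)%N - rho * f j.+1 *+ (j.+1 < n)%N.
Proof.
pose d i := 1 + rho ^+ 2 - rho ^+ 2 *+ (i == 0) - rho ^+ 2 *+ (i.+1 == n).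
transitivity (\sum_(i < n) ((f i * d i) *+ (i == j :> nat)
   - (rho * f i *+ (0 < j)%N) *+ (i == j.-1 :> nat)
   - rho * f i *+ (i == j.+1 :> nat))).
  apply: eq_bigr => i _; rewrite mxE /d.
  have -> : (i == j) = (i == j :> nat) by [].
  have -> : (i.+1 == j)%N = (0 < j)%N && (i == j.-1 :> nat) by case: (j : nat).
  rewrite (eq_sym j.+1).
  case: (0 < j)%N; case: (i == j :> nat); case: (i == j.-1 :> nat);
  case: (i == j.+1 :> nat); rewrite /= ?mulr1n ?mulr0n; ring.
rewrite !sumrB (sum_nat_delta (fun i => f i * d i)) ltn_ord mulr1n.
rewrite (sum_nat_delta (fun i => rho * f i *+ (0 < j)%N)).
rewrite (sum_nat_delta (fun i => rho * f i)) /d.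
by rewrite (leq_ltn_trans (leq_pred _) (ltn_ord j)).
Qed.

Lemma KMS_mul_tridiag (R : realType) (n : nat) (rho : R[i]) :
  (1 < n)%N -> KMS n rho *m kms_tridiag n rho = (1 - rho ^+ 2)%:M.
Proof.
move=> n1; apply/matrixP => k j; rewrite !mxE.
transitivity (\sum_(i < n) rho ^+ (maxn k i - minn k i) * kms_tridiag n rho i j).
  by apply: eq_bigr => i _; rewrite mxE.
rewrite (kms_tridiag_sum rho (fun i => rho ^+ (maxn k i - minn k i))).
have -> : (k == j) = (k == j :> nat) by [].
move: (ltn_ord j) (ltn_ord k); move: (j : nat) (k : nat) => {}j {}k jn kn.
case: (ltngtP k j) => [kj|jk|->].
(* Writing the gap as [a.+1] turns the exponents into [a], [a.+1], [a.+2], free of subtraction. *)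
- have [a ja] : exists a, j = (k + a.+1)%N by exists (j - k.+1)%N; lia.
  have -> : (j - k)%N = a.+1 by lia.
  have -> : (maxn k j.-1 - minn k j.-1)%N = a by lia.
  have -> : (maxn k j.+1 - minn k j.+1)%N = a.+2 by lia.
  have -> : (j == 0)%N = false by lia.
  have -> : (0 < j)%N by lia.
  have [e|e] := eqVneq j.+1 n.
    have -> : (j.+1 < n)%N = false by lia.
    by rewrite /= ?mulr1n ?mulr0n !exprS; ring.
  have -> : (j.+1 < n)%N by lia.
  by rewrite /= ?mulr1n ?mulr0n !exprS; ring.
- have [a ja] : exists a, k = (j + a.+1)%N by exists (k - j.+1)%N; lia.
  have -> : (k - j)%N = a.+1 by lia.
  have -> : (maxn k j.+1 - minn k j.+1)%N = a by lia.
  have -> : (j.+1 == n) = false by lia.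
  have -> : (j.+1 < n)%N by lia.
  have [e|e] := posnP j.
    by rewrite /= ?mulr1n ?mulr0n !exprS; ring.
  have -> : (maxn k j.-1 - minn k j.-1)%N = a.+2 by lia.
  by rewrite /= ?mulr1n ?mulr0n !exprS; ring.
- rewrite ?maxnn ?minnn subnn expr0.
  have -> : (maxn j j.+1 - minn j j.+1)%N = 1%N by lia.
  have [e|e] := posnP j.
    have -> : (j.+1 == n) = false by lia.
    have -> : (j.+1 < n)%N by lia.
    by rewrite /= ?mulr1n ?mulr0n; ring.
  have -> : (maxn j j.-1 - minn j j.-1)%N = 1%N by lia.
  have [f|f] := eqVneq j.+1 n.
    have -> : (j.+1 < n)%N = false by lia.
    by rewrite /= ?mulr1n ?mulr0n; ring.
  have -> : (j.+1 < n)%N by lia.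
  by rewrite /= ?mulr1n ?mulr0n; ring.
Qed.

(** * The identity for p_2n, and its zeros for real rho in (-1, 1) *)

(** Multiplying by z^2 - 1 collapses both geometric sums in z^2; no division is made, so z = 1 and z
    = -1 are covered. *)
Lemma p2n_horner (R : realType) (n : nat) (rho z : R[i]) :
  (z ^+ 2 - 1) * (p2n n.+1 rho).[z] =
  z ^+ (2 * n.+1) * (z - rho) ^+ 2 - (1 - rho * z) ^+ 2.
Proof.
set rhs := RHS; rewrite /p2n !hornerE !horner_sum.
pose G m := \sum_(0 <= k < m) (z ^+ 2) ^+ k.
have gs m : (z ^+ 2 - 1) * G m = (z ^+ 2) ^+ m - 1.
  elim: m => [|m IH]; first by rewrite /G big_nil expr0; ring.
  by rewrite /G big_nat_recr //= mulrDr -/(G m) IH (exprS (z ^+ 2)); ring.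
have e1 : \sum_(0 <= k < n.+1) ('X^(2 * k + 1)).[z] = z * G n.+1.
  by rewrite mulr_sumr; apply: eq_bigr => k _; rewrite !hornerE exprD expr1 exprM mulrC.
have e2 : \sum_(1 <= k < n.+1) ('X^(2 * k)).[z] = z ^+ 2 * G n.
  rewrite big_add1 mulr_sumr; apply: eq_bigr => k _.
  by rewrite !hornerE exprM (exprS (z ^+ 2)).
rewrite e1 e2 /rhs exprM.
rewrite (_ : (z ^+ 2 - 1) * _ = (z ^+ 2 - 1) * ((z ^+ 2) ^+ n.+1 + 1)
  + (1 + rho ^+ 2) * z ^+ 2 * ((z ^+ 2 - 1) * G n)
  - 2 * rho * z * ((z ^+ 2 - 1) * G n.+1)); last by ring.
rewrite !gs (exprS (z ^+ 2)); ring.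
Qed.

(** By [diff], |1 - rz| exceeds |z - r| inside the unit circle and falls below it outside, whereas
    the power of |z| in the root equation pushes the other way. This serves the case rho = 0 of (i)
    => (ii). *)
Lemma p2n_root_norm (R : realType) (n : nat) (r : R) (z : R[i]) :
  -1 < r < 1 -> root (p2n n.+1 r%:C) z -> `|z| = 1.
Proof.
move=> /andP[r_gtN1 r_lt1] /rootP pz0.
have := p2n_horner n r%:C z; rewrite pz0 mulr0 => /esym/eqP; rewrite subr_eq0 => /eqP eqz.
have {}eqz : `|z| ^+ (2 * n.+1) * `|z - r%:C| ^+ 2 = `|1 - r%:C * z| ^+ 2.
  by rewrite -!normrX -normrM eqz.
have rC : (r%:C)^*%R = r%:C by rewrite conj_Creal // complex_real.
have diff : `|1 - r%:C * z| ^+ 2 - `|z - r%:C| ^+ 2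
    = (1 - `|z| ^+ 2) * (1 - r ^+ 2)%:C.
  have -> : (1 - r ^+ 2)%:C = 1 - r%:C ^+ 2 by rewrite rmorphB rmorph1 rmorphXn.
  by rewrite !normCK !rmorphB !rmorphM rmorph1 /= !rC; ring.
have r2 : 0 < (1 - r ^+ 2)%:C :> R[i] by rewrite ltcR; nra.
have [zlt|zgt|//] := real_ltgtP (normr_real z) (@real1 _).
- have : `|z| ^+ (2 * n.+1) * `|z - r%:C| ^+ 2 <= `|z - r%:C| ^+ 2.
    by rewrite ler_piMl ?exprn_ge0 // exprn_ile1 // ltW.
  rewrite eqz -subr_le0 diff pmulr_lle0 // subr_le0.
  by rewrite lt_geF // expr_lt1.
- have : `|z - r%:C| ^+ 2 <= `|z| ^+ (2 * n.+1) * `|z - r%:C| ^+ 2.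
    by rewrite ler_peMl ?exprn_ge0 // exprn_ege1 // ltW.
  rewrite eqz -subr_ge0 diff pmulr_lge0 // subr_ge0.
  by rewrite lt_geF // expr_gt1.
Qed.

(** * Positive definiteness of K_n *)

(** In [R[i]], [0 < w] also says that w is real. The test vectors give the values 2 + 2 rho and 2 -
    2 rho, hence both the reality of rho and its bounds. *)
Lemma posdef_KMS_rho (R : realType) (n : nat) (rho : R[i]) :
  (1 < n)%N -> posdef (KMS n rho) ->
  complex.Im rho = 0 /\ -1 < complex.Re rho < 1.
Proof.
move=> n1 pd.
pose i0 : 'I_n := Ordinal (ltnW n1); pose i1 : 'I_n := Ordinal n1.
have test (s : R[i]) : s^*%C = s -> s * s = 1 -> 0 < 2 + 2 * (s * rho).
  move=> sC s2; pose x : 'cV[R[i]]_n := delta_mx i0 0 + s *: delta_mx i1 0.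
  have xn0 : x != 0.
    apply/eqP => /matrixP/(_ i0 0); rewrite !mxE !eqxx /= mulr0 addr0.
    by move/eqP; rewrite oner_eq0.
  have := pd x xn0.
  have -> : map_mx conjc x = x.
    apply/matrixP => i j; rewrite !mxE rmorphD rmorphM /= sC.
    by rewrite !rmorph_nat.
  have -> : x^T = delta_mx 0 i0 + s *: delta_mx 0 i1.
    by rewrite /x linearD linearZ /= !trmx_delta.
  rewrite /x mulmxDl -scalemxAl -!rowE.
  rewrite mulmxDr -scalemxAr -!colE !mxE /= !subnn !expr0 !expr1.
  rewrite (_ : _ + _ = 2 + 2 * (s * rho)) //.
  transitivity (1 + s * s + 2 * (s * rho)); first by ring.
  by rewrite s2.
have := test 1 (rmorph1 _) (mulr1 _); have := test (-1).
rewrite rmorphN1 mulrNN mulr1 => /(_ erefl erefl).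
case: rho {pd test} => a b; rewrite !ltcE /=.
by move=> /andP[/eqP h1 h2] /andP[/eqP h3 h4]; split; lra.
Qed.

(** The diagonal case of L D L^T. Passing from k to k + 1 multiplies the old sum by r^2 and adds 1 -
    r^2, so the value 1 persists. *)
Lemma sum_kms_factor (C : fieldType) (r : C) (k : nat) :
  \sum_(m < k.+1) (if m == 0 :> nat then 1 else 1 - r ^+ 2) * r ^+ (2 * (k - m))
  = 1.
Proof.
elim: k => [|k IH]; first by rewrite big_ord_recl big_ord0 /= expr0; ring.
rewrite big_ord_recr /= subnn expr0 mulr1.
rewrite (eq_bigr (fun m : 'I_k.+1 => r ^+ 2 *
  ((if m == 0 :> nat then 1 else 1 - r ^+ 2) * r ^+ (2 * (k - m))))).
  by rewrite -mulr_sumr IH; ring.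
move=> m _; have mk : (m <= k)%N := ltn_ord m.
by rewrite subSn // mulnS exprD mulrCA.
Qed.

(* The lower unitriangular factor L of K_n = L D L^T. *)
Definition kms_chol (C : fieldType) (n : nat) (r : C) : 'M[C]_n :=
  \matrix_(j < n, m < n) (if (m <= j)%N then r ^+ (j - m) else 0).

Lemma KMS_chol (R : realType) (n : nat) (rho : R[i]) :
  KMS n rho = kms_chol n rho
    *m diag_mx (\row_(m < n) (if m == 0 :> nat then 1 else 1 - rho ^+ 2))
    *m (kms_chol n rho)^T.
Proof.
apply/matrixP => j k; rewrite mul_mx_diag !mxE.
pose d m := if m == 0%N then 1 else 1 - rho ^+ 2.
(* Only m <= min(j, k) contributes, and (j - m) + (k - m) = |j - k| + 2 (min(j, k) - m). *)
transitivity (\sum_(m < n | (m < (minn j k).+1)%N) rho ^+ (maxn j k - minn j k) *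
   (d m * rho ^+ (2 * (minn j k - m)))).
  rewrite -mulr_sumr.
  rewrite -(big_ord_widen _ (fun m => d m * rho ^+ (2 * (minn j k - m)))).
    by rewrite sum_kms_factor mulr1.
  by rewrite gtn_min ltn_ord.
rewrite big_mkcond; apply: eq_bigr => m _; rewrite !mxE ltnS leq_min.
case: leqP => mj; last by rewrite !mul0r.
case: leqP => mk; last by rewrite mulr0.
rewrite -/(d m) mulrCA -exprD mulrAC -exprD mulrC; congr (rho ^+ _ * _).
by move: mj mk; move: (j : nat) (k : nat) (m : nat); lia.
Qed.

Lemma KMS_posdef (R : realType) (n : nat) (r : R) :
  -1 < r < 1 -> posdef (KMS n r%:C).
Proof.
move=> /andP[r_gtN1 r_lt1] x xn0; rewrite KMS_chol.
set L := kms_chol n r%:C; set d := \row_m _.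
pose y := L^T *m x.
have Lu : L \in unitmx.
  rewrite unitmxE det_trig; last first.
    by apply/is_trig_mxP => i j ij; rewrite mxE leqNgt ij.
  by rewrite big1 ?unitr1 // => i _; rewrite mxE leqnn subnn.
have yn0 : y != 0.
  apply: contra_neq xn0 => y0; rewrite -[x]mul1mx -(mulVmx (_ : L^T \in unitmx)) ?unitmx_tr //.
  by rewrite -mulmxA -/y y0 mulmx0.
(* As r is real, L^T is the adjoint of L, and the quadratic form becomes y^* D y. *)
have yE : (map_mx conjc x)^T *m L = (map_mx conjc y)^T.
  rewrite map_mxM trmx_mul; congr (_ *m _); rewrite -map_trmx trmxK.
  apply/matrixP => i j; rewrite !mxE; case: ifP => _; last by rewrite rmorph0.
  by rewrite rmorphXn /= oppr0.
have dE m : 0 < d 0 m.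
  by rewrite mxE; case: eqP => // _; rewrite -rmorphXn -rmorphB ltcR; nra.
rewrite !mulmxA yE -mulmxA -/y mul_mx_diag mxE.
clearbody d y; have /cV0Pn[i yi] := yn0.
have yy j : (y j 0)^*%C * d 0 j * y j 0 = d 0 j * `|y j 0| ^+ 2.
  by rewrite sqr_normc; ring.
rewrite (bigD1 i) //= ltr_pwDl //.
  by rewrite !mxE yy mulr_gt0 // exprn_gt0 // normr_gt0.
by apply: sumr_ge0 => j _; rewrite !mxE yy mulr_ge0 ?exprn_ge0 // ltW.
Qed.

(** * From zeros of p_2n to eigenvalues of K_n *)

(** The quadratic factors as (z - e^(it)) (z - e^(-it)). *)
Lemma unit_root_cos (R : realType) (z : R[i]) (t : R) :
  z ^+ 2 + 1 = 2 * (cos t)%:C * z -> `|z| = 1.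
Proof.
move=> eqz.
have : (z - (cos t +i* sin t)) * (z - (cos t -i* sin t)) = 0.
  have e1 : (cos t +i* sin t) * (cos t -i* sin t) = 1.
    apply/eqP; rewrite eq_complex /= -(cos2Dsin2 t); apply/andP; split; apply/eqP; ring.
  have e2 : (cos t +i* sin t) + (cos t -i* sin t) = 2 * (cos t)%:C.
    apply/eqP; rewrite eq_complex /=; apply/andP; split; apply/eqP; ring.
  rewrite (_ : _ * _ = z ^+ 2 - ((cos t +i* sin t) + (cos t -i* sin t)) * z
    + (cos t +i* sin t) * (cos t -i* sin t)); last by ring.
  by rewrite e1 e2 -eqz; ring.
move/eqP; rewrite mulf_eq0 !subr_eq0 => /orP[]/eqP ->;
  by rewrite normc_def /= ?sqrrN cos2Dsin2 sqrtr1.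
Qed.

Lemma KMS_eigenvalue_root (R : realType) (n : nat) (rho z : R[i]) :
  (1 < n)%N -> rho ^+ 2 != 1 -> z ^+ 2 != 1 -> z != 0 ->
  z ^+ (2 * n) * (z - rho) ^+ 2 = (1 - rho * z) ^+ 2 ->
  [/\ (1 - rho * z) * (z - rho) != 0 &
      eigenvalue (KMS n rho) ((1 - rho ^+ 2) * z / ((1 - rho * z) * (z - rho)))].
Proof.
move=> n1 rho2 z2 z0 eqz.
have zr : z - rho != 0.
  apply: contra rho2; rewrite subr_eq0 => /eqP zr; move/esym/eqP: eqz.
  by rewrite zr subrr expr0n mulr0 sqrf_eq0 subr_eq0 eq_sym expr2.
have rz : 1 - rho * z != 0.
  apply: contraNneq zr => rz; move/eqP: eqz; rewrite rz expr0n mulf_eq0 !expf_eq0 /=.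
  by rewrite (negPf z0) andbF.
split; first by rewrite mulf_neq0.
(* Taking square roots in [eqz] leaves a sign [d]; it decides whether the eigenvector is symmetric
   or antisymmetric under reversal. *)
have [d [d2 zd]] : exists d : R[i], d * d = 1 /\ d * z ^+ n * (rho - z) = 1 - rho * z.
  have : (z ^+ n * (z - rho)) ^+ 2 == (1 - rho * z) ^+ 2.
    by rewrite exprMn -exprM mulnC eqz.
  rewrite eqf_sqr => /orP[]/eqP e; [exists (-1)|exists 1]; split; try by ring.
    by rewrite -e; ring.
  by rewrite -[RHS]opprK -e; ring.
(* The boundary conditions w0 and wn absorb the corner entries of T. *)
pose w k := z ^+ k + d * z ^+ (n.+1 - k).
have w0 : w 0%N = rho * w 1%N.
  rewrite /w subn0 expr0 subSS subn0 expr1 exprS.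
  apply/eqP; rewrite -subr_eq0; apply/eqP.
  transitivity ((1 - rho * z) - d * z ^+ n * (rho - z)); first by ring.
  by rewrite zd subrr.
have wn : w n.+1 = rho * w n.
  have wd m : w m = d * (d * z ^+ m + z ^+ (n.+1 - m)) by rewrite /w mulrDr mulrA d2 mul1r.
  rewrite !wd subnn expr0 subSnn expr1 exprS.
  apply/eqP; rewrite -subr_eq0; apply/eqP.
  transitivity (d * ((1 - rho * z) - d * z ^+ n * (rho - z))); first by ring.
  by rewrite zd subrr mulr0.
have wS k : (k < n)%N -> z * (w k + w k.+2) = (z ^+ 2 + 1) * w k.+1.
  move=> kn; rewrite /w; have [m ->] : exists m, n = (k + m.+1)%N by exists (n - k.+1)%N; lia.
  have -> : ((k + m.+1).+1 - k = m.+2)%N by lia.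
  have -> : ((k + m.+1).+1 - k.+1 = m.+1)%N by lia.
  have -> : ((k + m.+1).+1 - k.+2 = m)%N by lia.
  rewrite !exprS; ring.
pose v : 'rV[R[i]]_n := \row_j w j.+1.
(* [tau] is 1 - rho (z + 1/z) + rho^2, the eigenvalue of T at [v]; that of K_n is (1 - rho^2) /
   [tau]. *)
pose tau := (1 - rho * z) * (z - rho) / z.
have zt : z * tau = (1 - rho * z) * (z - rho) by rewrite /tau; field.
have vT : v *m kms_tridiag n rho = tau *: v.
  apply/rowP => j; rewrite !mxE.
  transitivity (\sum_(i < n) w i.+1 * kms_tridiag n rho i j).
    by apply: eq_bigr => i _; rewrite mxE.
  rewrite (kms_tridiag_sum rho (fun i => w i.+1)).
  apply: (mulfI z0); rewrite mulrA zt.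
  transitivity (z * ((1 + rho ^+ 2) * w j.+1 - rho * w j - rho * w j.+2)).
    congr (z * _); have jn := ltn_ord j.
    have [e|e] := posnP j; rewrite ?e /=; have [f|f] := eqVneq j.+1 n.
    - by move: n1; rewrite -f e.
    - have -> : (1 < n)%N by lia.
      have -> : (1%N == n) = false by lia.
      by rewrite w0 !mulr1n !mulr0n; ring.
    - rewrite f ltnn wn prednK //= !mulr1n !mulr0n; ring.
    - have -> : (j.+1 < n)%N by lia.
      by rewrite prednK // !mulr1n !mulr0n; ring.
  transitivity (z * (1 + rho ^+ 2) * w j.+1 - rho * (z * (w j + w j.+2))); first by ring.
  by rewrite wS ?ltn_ord //; ring.
apply/eigenvalueP; exists v.
  have tau0 : tau != 0 by rewrite mulf_neq0 ?invr_eq0 // mulf_neq0.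
  have KT := KMS_mul_tridiag rho n1.
  have c0 : 1 - rho ^+ 2 != 0 by rewrite subr_eq0 eq_sym.
  have TK : kms_tridiag n rho *m KMS n rho = (1 - rho ^+ 2)%:M.
    have : ((1 - rho ^+ 2)^-1 *: KMS n rho) *m kms_tridiag n rho = 1%:M.
      by rewrite -scalemxAl KT scale_scalar_mx mulVf.
    move/mulmx1C; rewrite -scalemxAr => /(congr1 (fun M => (1 - rho ^+ 2) *: M)).
    by rewrite scalerA mulfV // scale1r scale_scalar_mx mulr1.
  have -> : (1 - rho ^+ 2) * z / ((1 - rho * z) * (z - rho)) = (1 - rho ^+ 2) / tau.
    by rewrite /tau; field; rewrite z0 zr rz.
  rewrite mulrC -scalerA -[_ *: v]mul_mx_scalar -TK mulmxA vT -scalemxAl scalerA.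
  by rewrite mulVf // scale1r.
(* If [v] vanished, its first two entries would give z w_2 - w_1 = z (z^2 - 1) = 0, against [z0] and
   [z2]. *)
apply/eqP => v0; case/negP: z2.
have wz k : (k < n)%N -> w k.+1 = 0.
  by move=> kn; move/rowP/(_ (Ordinal kn)): v0; rewrite !mxE.
rewrite -subr_eq0; apply/eqP.
have [m nm] : exists m, n = m.+2 by exists n.-2; lia.
have := wz _ n1; have := wz 0%N (ltnW n1).
rewrite /w nm !subSS !subn0 => h1 h2; apply: (mulfI z0); rewrite mulr0.
transitivity (z * (z ^+ 2 + d * z ^+ m.+1) - (z ^+ 1 + d * z ^+ m.+2)).
  by rewrite !exprS; ring.
by rewrite h1 h2; ring.
Qed.

(** * Gershgorin bounds for the eigenvalues *)

(* In the two boundary rows T has diagonal entry 1 and Gershgorin radius |r|; since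
   r^2 <= |r|, these discs lie in the interior one. *)
Lemma kms_disc_bound (R : realFieldType) (r t : R) (j n : nat) :
  (j < n)%N -> (1 < n)%N -> `|r| < 1 ->
  `|t - (1 + r ^+ 2 - r ^+ 2 *+ (j == 0)%N - r ^+ 2 *+ (j.+1 == n))|
    <= `|r| * ((0 < j)%N + (j.+1 < n)%N)%:R ->
  `|t - (1 + r ^+ 2)| <= 2 * `|r|.
Proof.
move=> jn n1 r1; set D := (X in t - X) => bound.
have rr : r ^+ 2 <= `|r|.
  by rewrite -real_normK ?num_real // expr2 ler_piMl // ltW.
have r0 := normr_ge0 r.
apply: le_trans (_ : `|t - D| + `|D - (1 + r ^+ 2)| <= _).
  by rewrite -(subrKA D) ler_normD.
have edge b c : (b && ~~ c) || (c && ~~ b) ->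
    `|1 + r ^+ 2 - r ^+ 2 *+ b - r ^+ 2 *+ c - (1 + r ^+ 2)| = r ^+ 2.
  move=> bc; rewrite -[RHS]ger0_norm ?sqr_ge0 // -normrN; congr `|_|.
  by move: b c bc => [] [] //= _; ring.
move: bound; rewrite /D {D}; case: j jn => [|j] jn.
  have -> : (1 == n)%N = false by lia.
  by rewrite edge // n1 mulr1 => ?; lra.
have -> : (j.+2 < n)%N = (j.+2 != n) by lia.
case: (j.+2 == n); first by rewrite edge // mulr1 => ?; lra.
by rewrite /= ?mulr0n !subr0 subrr normr0 => ?; lra.
Qed.

(** Positive definiteness makes [l] a positive real, so [t] = (1 - r^2) / [l] is a positive
    eigenvalue of T with the same left eigenvector, and Gershgorin's argument applies to it. *)
Lemma KMS_eigenvalue_bound (R : realType) (n : nat) (r : R) (l : R[i]) :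
  (1 < n)%N -> -1 < r < 1 -> eigenvalue (KMS n r%:C) l ->
  exists2 t : R, l = (1 - r ^+ 2)%:C / t%:C & 0 < t /\ `|t - (1 + r ^+ 2)| <= 2 * `|r|.
Proof.
move=> n1 hr /eigenvalueP[v vK vn0].
have r2 : 0 < 1 - r ^+ 2 by move/andP: hr => [? ?]; nra.
have r1 : `|r| < 1 by rewrite ltr_norml.
pose x : 'cV_n := (map_mx conjc v)^T.
have vE : (map_mx conjc x)^T = v by apply/matrixP => i j; rewrite !mxE conjcK.
have x0 : x != 0.
  apply: contra_neq vn0 => x0; rewrite -vE x0 map_mx0. by rewrite trmx0.
have /cV0Pn[i0 xi0] := x0.
have vx j : v 0 j * x j 0 = `|v 0 j| ^+ 2 by rewrite !mxE sqr_normc.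
have l_gt0 : 0 < l.
  have := KMS_posdef hr x0; rewrite vE vK -scalemxAl mxE => h.
  rewrite -(pmulr_lgt0 _ (_ : 0 < (v *m x) 0 0)) // mxE (bigD1 i0) //= ltr_pwDl //.
    rewrite vx exprn_gt0 // normr_gt0; apply: contra xi0 => /eqP vi0.
    by rewrite !mxE vi0 rmorph0.
  by apply: sumr_ge0 => j _; rewrite vx exprn_ge0.
have [c lc] : exists c : R, l = c%:C.
  by apply/complex_realP; rewrite realE ltW.
move: l_gt0 vK; rewrite {l}lc ltcR => c_gt0 vK.
pose t := (1 - r ^+ 2) / c.
have t_gt0 : 0 < t by rewrite divr_gt0.
exists t.
  by rewrite -fmorphV -rmorphM /t; congr (_%:C); field; rewrite !gt_eqF.
split=> //.
have vT : v *m kms_tridiag n r%:C = t%:C *: v.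
  have := congr1 (mulmx v) (KMS_mul_tridiag r%:C n1).
  rewrite mulmxA vK -scalemxAl mul_mx_scalar => /(congr1 (fun w => (c^-1)%:C *: w)).
  rewrite !scalerA -rmorphM mulVf ?gt_eqF // rmorph1 scale1r => ->.
  by rewrite -rmorphXn -[1]/(1%:C) -rmorphB -rmorphM mulrC.
have norm_real (u : R) : `|u%:C| = `|u|%:C.
  by rewrite normc_def /= expr0n addr0 sqrtr_sqr.
(* An entry of largest modulus is selected through the real-valued [normc], because the order on
   [R[i]] is not total. *)
case: (arg_maxP (P := xpredT) (i0 := i0) (fun j => ComplexField.Normc.normc (v 0 j)) isT) => j _ jmax.
have {}jmax i : `|v 0 i| <= `|v 0 j| by rewrite lecR; apply: jmax.
have vj_gt0 : 0 < `|v 0 j|.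
  apply: lt_le_trans (jmax i0); rewrite normr_gt0; apply: contra xi0 => /eqP vi0.
  by rewrite !mxE vi0 rmorph0.
(* [f] extends [v] by zero to [nat], as [kms_tridiag_sum] expects. *)
pose f k := if insub k is Some i then v 0 i else 0.
have f_le k : `|f k| <= `|v 0 j|.
  by rewrite /f; case: insub => [i|]; rewrite ?jmax ?normr0 ?normr_ge0.
pose D : R := 1 + r ^+ 2 - r ^+ 2 *+ (j == 0 :> nat) - r ^+ 2 *+ (j.+1 == n).
have tD : (t - D)%:C * v 0 j
    = - (r%:C * f j.-1 *+ (0 < j)%N + r%:C * f j.+1 *+ (j.+1 < n)%N).
  move/rowP/(_ j): vT; rewrite !mxE.
  rewrite (eq_bigr (fun i : 'I_n => f i * kms_tridiag n r%:C i j)); last first.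
    by move=> i _; rewrite /f valK.
  rewrite kms_tridiag_sum {1}/f valK => e.
  rewrite rmorphB mulrBl -e /D !(rmorphB, rmorphD, rmorphMn, rmorphXn, rmorph1) /=.
  ring.
have bound : `|t - D| <= `|r| * ((0 < j)%N + (j.+1 < n)%N)%:R.
  rewrite -lecR -norm_real -(ler_pM2r vj_gt0) -normrM tD normrN.
  apply: le_trans (ler_normD _ _) _.
  rewrite rmorphM rmorph_nat natrD mulrDr mulrDl lerD //= -norm_real.
    by case: (0 < j)%N; rewrite ?mulr1n ?mulr0n ?normr0 ?mulr0 ?mul0r // mulr1 normrM ler_wpM2l.
  by case: (j.+1 < n)%N; rewrite ?mulr1n ?mulr0n ?normr0 ?mulr0 ?mul0r // mulr1 normrM ler_wpM2l.
exact: kms_disc_bound (ltn_ord j) n1 r1 bound.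
Qed.

(** * Zeros on the unit circle force rho into (-1, 1) *)

(** Logarithmic derivative at 0: -p'(0)/p(0) is the sum of the reciprocals of the zeros. For p_2n,
    whose lowest coefficients are 1 and -2 rho, that sum is 2 rho. *)
Lemma coef1_prod_XsubC (F : fieldType) (s : seq F) :
  0 \notin s ->
  (\prod_(a <- s) ('X - a%:P))`_1 =
  - (\prod_(a <- s) ('X - a%:P))`_0 * \sum_(a <- s) a^-1.
Proof.
elim: s => [|a s IH]; first by rewrite !big_nil coef1 mulr0.
rewrite inE negb_or => /andP[a0 /IH {}IH].
rewrite !big_cons !mulrBl !coefB !coefXM !coefCM /= IH; field.
by rewrite eq_sym.
Qed.

Lemma p2n_coef (R : realType) (n : nat) (rho : R[i]) (i : nat) :
  (p2n n.+2 rho)`_i =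
  if (i <= 2 * n.+2)%N then
    if odd i then - (2 * rho)
    else if (i == 0)%N || (i == 2 * n.+2)%N then 1 else 1 + rho ^+ 2
  else 0.
Proof.
rewrite /p2n !(coefD, coefN, coefZ, coefXn, coef1, coef_sum).
have e1 : \sum_(1 <= k < n.+2) 'X^(2 * k)`_i
    = (~~ odd i && (0 < i < 2 * n.+2)%N)%:R :> R[i].
  have [h|h] := boolP (~~ odd i && (0 < i < 2 * n.+2)%N).
    rewrite (bigD1_seq i./2) ?iota_uniq ?mem_index_iota //=; last by lia.
    rewrite big1 ?addr0; first by rewrite coefXn; have -> : i == (2 * i./2)%N by lia.
    by move=> k ki; rewrite coefXn; have -> : i == (2 * k)%N = false by lia.
  rewrite big_seq big1 // => k; rewrite mem_index_iota => hk.
  by rewrite coefXn; have -> : i == (2 * k)%N = false by lia.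
have e2 : \sum_(0 <= k < n.+2) 'X^(2 * k + 1)`_i
    = (odd i && (i < 2 * n.+2)%N)%:R :> R[i].
  have [h|h] := boolP (odd i && (i < 2 * n.+2)%N).
    rewrite (bigD1_seq i./2) ?iota_uniq ?mem_index_iota //=; last by lia.
    rewrite big1 ?addr0; first by rewrite coefXn; have -> : i == (2 * i./2 + 1)%N by lia.
    by move=> k ki; rewrite coefXn; have -> : i == (2 * k + 1)%N = false by lia.
  rewrite big_seq big1 // => k; rewrite mem_index_iota => hk.
  by rewrite coefXn; have -> : i == (2 * k + 1)%N = false by lia.
rewrite e1 e2.
have [->|i0] := posnP i; first by rewrite /=; ring.
have [->|iN] := eqVneq i (2 * n.+2)%N.
  have -> : odd (2 * n.+2) = false by lia.
  by rewrite ltnn leqnn /=; ring.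
have -> : (i < 2 * n.+2)%N = (i <= 2 * n.+2)%N by lia.
by case: (i <= _)%N; case: (odd i); rewrite /=; ring.
Qed.

Lemma p2n_unit_roots_real (R : realType) (n : nat) (rho : R[i]) :
  (forall z, root (p2n n.+2 rho) z -> `|z| = 1) -> complex.Im rho = 0.
Proof.
set p := p2n _ _ => unit_roots.
have pN : p`_(2 * n.+2) = 1.
  by rewrite p2n_coef leqnn eqxx orbT; have -> : odd (2 * n.+2) = false by lia.
have sp : size p = (2 * n.+2).+1.
  apply/eqP; rewrite eqn_leq; apply/andP; split.
    by apply/leq_sizeP => j hj; rewrite p2n_coef leqNgt hj.
  by rewrite ltnNge; apply/negP => /leq_sizeP/(_ _ (leqnn _))/eqP; rewrite pN oner_eq0.
have [s ps] := closed_field_poly_normal p.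
have {}ps : p = \prod_(a <- s) ('X - a%:P) by rewrite ps lead_coefE sp pN scale1r.
have ss : size s = (2 * n.+2)%N by move: sp; rewrite ps size_prod_XsubC => -[].
have s_unit a : a \in s -> `|a| = 1.
  by move=> sa; apply: unit_roots; rewrite ps root_prod_XsubC.
have sum_s : \sum_(a <- s) a = 2 * rho.
  apply: oppr_inj; rewrite -coefPn_prod_XsubC ss // -ps p2n_coef.
  have -> : odd (2 * n.+2).-1 by lia.
  by have -> : ((2 * n.+2).-1 <= 2 * n.+2)%N by lia.
have sum_sV : \sum_(a <- s) a^-1 = 2 * rho.
  have : 0 \notin s by apply/negP => /s_unit/eqP; rewrite normr0 eq_sym oner_eq0.
  move/coef1_prod_XsubC; rewrite -ps !p2n_coef /= mulN1r => /oppr_inj <- //.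
have : (2 * rho)^*%C = 2 * rho.
  rewrite -{1}sum_s -sum_sV rmorph_sum big_seq [RHS]big_seq.
  apply: eq_bigr => a /s_unit a1; have a0 : a != 0 by rewrite -normr_eq0 a1 oner_eq0.
  by apply: (mulfI a0); rewrite -sqr_normc a1 mulfV // expr1n.
case: (rho) => x y /eqP; rewrite eq_complex /= => /andP[_ /eqP]; lra.
Qed.

Lemma p2n_unit_roots_lt1 (R : realType) (n : nat) (r : R) :
  r ^+ 2 != 1 -> (forall z, root (p2n n.+2 r%:C) z -> `|z| = 1) -> -1 < r < 1.
Proof.
move=> r2 unit_roots; rewrite -ltr_norml ltNge; apply/negP => r_ge1.
have r2_gt1 : 1 < r ^+ 2.
  by rewrite lt_neqAle eq_sym r2 -real_normK ?num_real // exprn_ege1.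
(* [h] is the right-hand side of the identity as a real polynomial, so that the intermediate value
   theorem applies. *)
pose h : {poly R} := 'X^(2 * n.+2) * ('X - r%:P) ^+ 2 - (1 - r *: 'X) ^+ 2.
have hE x : h.[x] = (x ^+ 2) ^+ n.+2 * (x - r) ^+ 2 - (1 - r * x) ^+ 2.
  by rewrite !hornerE exprM.
have hr : h.[r] <= 0 by rewrite hE subrr expr0n mulr0 sub0r oppr_le0 sqr_ge0.
have h2r : 0 <= h.[2 * r].
  rewrite hE (_ : (2 * r) ^+ 2 = 4 * r ^+ 2); last by ring.
  rewrite (_ : (2 * r - r) ^+ 2 = r ^+ 2); last by ring.
  rewrite (_ : 1 - r * (2 * r) = 1 - 2 * r ^+ 2); last by ring.
  (* With q = r^2 > 1 it remains to see that (4q)^(n+2) q >= 16 q^3 >= (1 - 2q)^2. *)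
  move: (r ^+ 2) r2_gt1 => q q1; rewrite subr_ge0.
  have q_pow : (4 * q) ^+ 2 <= (4 * q) ^+ n.+2 by rewrite ler_weXn2l //; lra.
  have h1 : (4 * q) ^+ 2 * q <= (4 * q) ^+ n.+2 * q by rewrite ler_wpM2r //; lra.
  apply: le_trans h1; rewrite -subr_ge0.
  rewrite (_ : _ - _ = 16 * (q ^+ 2 * (q - 1)) + 12 * q ^+ 2 + 4 * q - 1); last by ring.
  have q2 := sqr_ge0 q.
  have : 0 <= q ^+ 2 * (q - 1) by rewrite mulr_ge0 // subr_ge0 ltW.
  by lra.
(* The zero lies between r and 2r, so its modulus is at least |r|. For r < 0 the interval is [2r, r]
   and the sign change is reversed, hence [- h]. *)
have [x x2 hx] : exists2 x, r ^+ 2 <= x ^+ 2 & h.[x] = 0.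
  have [r0|r0] := leP 0 r.
    have [||x /andP[rx _] /rootP hx] := @poly_ivt R h r (2 * r); first by lra.
      by rewrite hr h2r.
    by exists x => //; nra.
  have [||x /andP[_ xr] /rootP hx] := @poly_ivt R (- h) (2 * r) r; first by lra.
    by rewrite !hornerN oppr_le0 oppr_ge0 hr h2r.
  by exists x; [nra|apply/eqP; rewrite -oppr_eq0 -hornerN hx].
have xx : x ^+ 2 != 1 by rewrite gt_eqF // (lt_le_trans r2_gt1).
have /unit_roots : root (p2n n.+2 r%:C) x%:C.
  have := p2n_horner n.+1 r%:C x%:C.
  have -> : x%:C ^+ (2 * n.+2) * (x%:C - r%:C) ^+ 2 - (1 - r%:C * x%:C) ^+ 2 = (h.[x])%:C.
    rewrite hE exprM rmorphB rmorphM !rmorphXn !rmorphB rmorph1. by rewrite rmorphM.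
  rewrite hx => /eqP; rewrite mulf_eq0 => /orP[|//].
  by rewrite -rmorphXn subr_eq0 -(rmorph1 (real_complex R)) (inj_eq (@complexI _)) (negPf xx).
move=> /(congr1 (fun y => y ^+ 2)); rewrite expr1n -add_Re2_Im2 /= expr0n addr0.
by move=> /eqP; rewrite -(rmorph1 (real_complex R)) (inj_eq (@complexI _)) (negPf xx).
Qed.

(** * Closing the cycle of implications *)

Theorem theorem3p5 (R : realType) (n : nat) (rho : R[i])
  (hn : (2 <= n)%N) (hrho1 : rho != 1) (hrhom1 : rho != -1) :
  [<-> (forall lambda : R[i], eigenvalue (KMS n rho) lambda -> sigma_range rho lambda);
       (forall z : R[i], root (p2n n rho) z -> `|z| = 1);
       (complex.Im rho = 0 /\ (-1 < complex.Re rho < 1)%R);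
       posdef (KMS n rho)].
Proof.
have rho2 : rho ^+ 2 != 1 by rewrite -subr_eq0 subr_sqr_1 mulf_neq0 // ?subr_eq0 // addr_eq0.
have rhoE : complex.Im rho = 0 -> rho = (complex.Re rho)%:C.
  by case: (rho) => a b /= ->.
tfae.
(* For rho = 0 the range of sigma is {1} and says nothing about z, so this case is settled by
   [p2n_root_norm]. *)
- move=> eigs z; have [rho0|rho0] := eqVneq rho 0.
    rewrite rho0 -(rmorph0 (real_complex R)); case: n hn {eigs} => [//|m _].
    by apply: p2n_root_norm; rewrite ltr01 oppr_lt0 ltr01.
  have [z2 _|z2] := eqVneq (z ^+ 2) 1.
    by apply/eqP; rewrite -(pexpr_eq1 (n := 2)) // -normrX z2 normr1.
  case: n hn eigs => [//|m hm] eigs /rootP pz0.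
  have := p2n_horner m rho z; rewrite pz0 mulr0 => /esym/eqP; rewrite subr_eq0 => /eqP eqz.
  have z0 : z != 0.
    apply/eqP => z0; move/eqP: eqz; rewrite z0 mulr0 subr0 expr1n expr0n.
    by rewrite muln_eq0 /= mul0r eq_sym oner_eq0.
  have [den /eigs[t [_ _ sden]]] := KMS_eigenvalue_root hm rho2 z2 z0 eqz.
  rewrite /sigma; set s := 1 - _ + _ in sden *; set w := (1 - rho * z) * _ in den *.
  have c0 : 1 - rho ^+ 2 != 0 by rewrite subr_eq0 eq_sym.
  rewrite -mulrA => /(mulfI c0) zw.
  have sw : z * s = w by rewrite -[s]invrK -zw; field; rewrite z0 den.
  (* Here z [s] - [w] = rho (z^2 + 1 - 2 z cos t), and the nonzero factor rho cancels. *)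
  apply: (unit_root_cos (t := t)); apply: (mulfI rho0).
  transitivity (rho * (2 * (cos t)%:C * z) + (z * s - w)); first by rewrite /s /w; ring.
  by rewrite sw subrr addr0.
- case: n hn => [//|[//|m]] _ roots; have im := p2n_unit_roots_real roots; split=> //.
  move: roots rho2; rewrite (rhoE im) -rmorphXn -(rmorph1 (real_complex R)).
  by rewrite (inj_eq (@complexI _)) => roots r2; apply: p2n_unit_roots_lt1 roots.
- by move=> [/rhoE-> hr]; apply: KMS_posdef.
- move=> pd; have [/rhoE rE hr] := posdef_KMS_rho hn pd; rewrite rE.
  move=> l /(KMS_eigenvalue_bound hn hr); move: (complex.Re rho) hr => r hr.
  move=> [t -> [t_gt0 bound]].
  (* [c] solves t = 1 - 2 r c + r^2, and the Gershgorin bound says |c| <= 1. For r = 0 the quotient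
     is 0 by convention, and the bound forces t = 1. *)
  pose c := (1 + r ^+ 2 - t) / (2 * r).
  have [c1 c2] : -1 <= c <= 1 /\ 2 * r * c = 1 + r ^+ 2 - t.
    have [r0|r0] := eqVneq r 0.
      rewrite /c r0 mulr0 invr0 mulr0 oppr_le0 ler01; split=> //.
      by move: bound; rewrite r0 normr0 expr0n /= mulr0 normr_le0 => /eqP; lra.
    have cE : 2 * r * c = 1 + r ^+ 2 - t by rewrite /c; field.
    split=> //; rewrite -ler_norml -(ler_pM2l (_ : 0 < `|2 * r|)).
      by rewrite -normrM cE mulr1 normrM (ger0_norm (ler0n _ 2)) distrC.
    by rewrite normr_gt0 mulf_neq0 // pnatr_eq0.
  have tE : 1 - 2 * r%:C * (cos (acos c))%:C + r%:C ^+ 2 = t%:C.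
    rewrite acosK ?in_itv //; transitivity ((1 - 2 * r * c + r ^+ 2)%:C).
      by rewrite rmorphD rmorphB rmorphXn !rmorphM rmorph1 rmorph_nat.
    by rewrite c2; congr (_%:C); ring.
  exists (acos c); split.
  + by apply: lt_le_trans (acos_ge0 c1); rewrite oppr_lt0 pi_gt0.
  + exact: acos_lepi.
  + by rewrite tE (inj_eq (@complexI _) t 0) gt_eqF.
  + by rewrite /sigma tE rmorphB rmorph1 rmorphXn.
Qed.
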